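(* Let $k\ge 2$. Every finite subset $K$ of $\mathbb{R}^k$ having at least two elements is a Jackson set; that is, there is no set $S\subset\mathbb{R}^k$ that intersects every congruent copy of $K$ in exactly one point.
   Context: A congruent copy of $K\subset\mathbb{R}^k$ is a set of the form $\sigma(K)$, where $\sigma$ is an isometry (distance-preserving bijection) of $\mathbb{R}^k$ onto itself. A set $S\subset\mathbb{R}^k$ is a Steinhaus set for $K$ if $S$ intersects every congruent copy of $K$ in exactly one point. A finite set $K\subset\mathbb{R}^k$ is a Jackson set if there is no Steinhaus set for $K$. *)

(* Defs.v *)
From mathcomp Require Import all_boot all_order all_algebra.
From mathcomp Require Import all_classical all_reals.

Set Implicit Arguments.
Unset Strict Implicit.
Unset Printing Implicit Defensive.

Import Order.TTheory GRing.Theory Num.Theory.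

Local Open Scope classical_set_scope.
Local Open Scope ring_scope.

(* The norm that MathComp-Analysis puts on 'rV[R]_k is the sup norm, so the
   Euclidean distance on R^k is written out. *)
Definition edist (R : realType) (k : nat) (x y : 'rV[R]_k) : R :=
  Num.sqrt (\sum_(i < k) (x ord0 i - y ord0 i) ^+ 2).

Definition euclidean_isometry (R : realType) (k : nat)
    (sigma : 'rV[R]_k -> 'rV[R]_k) : Prop :=
  bijective sigma /\ forall x y, edist (sigma x) (sigma y) = edist x y.

Definition congruent_copy (R : realType) (k : nat)
    (K L : set 'rV[R]_k) : Prop :=
  exists sigma, euclidean_isometry sigma /\ L = sigma @` K.

Definition steinhaus_set (R : realType) (k : nat)
    (K S : set 'rV[R]_k) : Prop :=
  forall L, congruent_copy K L -> exists! x, (S `&` L) x.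

Definition jackson_set (R : realType) (k : nat) (K : set 'rV[R]_k) : Prop :=
  finite_set K /\ ~ exists S, steinhaus_set K S.

(* Main.v *)
From HB Require Import structures.
Require Import Defs.
From mathcomp Require Import all_boot all_order all_algebra.
From mathcomp Require Import all_classical all_reals.
From mathcomp Require Import complex zify ring.

Set Implicit Arguments.
Unset Strict Implicit.
Unset Printing Implicit Defensive.

Import Order.TTheory GRing.Theory Num.Theory.

Local Open Scope ring_scope.

(** Let K have n points and suppose that S meets every congruent copy of K
    once.  Then the indicator f of S satisfies [sum_(x in K) f (t + g x) = 1]
    for all translations t and all orthogonal maps g.

    Dilation.  In characteristic p the operator [(sum_x T_x)^p] is
    [sum_x T_(p x)], where [T_x f t = f (t + x)].  As f takes the values 0 and
    1, for a prime p > n the sum of f over a copy of pK is congruent to 1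
    modulo p and lies between 0 and n, so it is 1.  Iterating, the relation
    holds for rK for every [r = 1 + j Q] with [Q = n!]
    ([tiles_dilate_fact]).

    Periods.  Let D be the set of the differences d of the other points of K
    with one of its points.  The function [h = n f - 1] satisfies
    [h t + sum_(d in D) h (t + (1 + j Q) g d) = 0] for all j, and so does every
    difference of translates of h; such functions are called killed.
    Eliminating the terms of these relations one at a time leaves the product,
    over d in D, of the difference operators along [Q g d] applied to h
    ([killed_product]).  Hence, to show that killed functions are 0, it is
    enough to treat those which, for each g of a given finite set, have one of
    the [Q g d] as a period ([branch_on_periods]).  The periods of h form a
    subgroup H.  If g x is in H for all x in D, the relation for h reads
    [n h = 0].  It remains to find finitely many g such that a subgroup that
    contains some [Q g d] for each of them contains, for one and the same
    orthogonal map g, all the g x.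

    Unit complex numbers.  First let g range over the rotations of one
    coordinate plane, identified with C; after a generic reflection of K all
    the d have nonzero projections d' to this plane.  The key fact is that
    every unit t has a large finite set Y of units that is nearly invariant
    under t relative to all subgroups: for every affine map E from C to a group
    and every subgroup H, few y in Y satisfy [E y \in H] without
    [N E (t y) \in H], where N depends on Y only ([nearly_invariant_exists]).
    For [t = tau^2] the set consists of the [t^i B_a], [B_a] being the
    Blaschke factor [(tau - a) / (1 - a tau)] with a an integer.  The linear
    relation [B_a - a tau B_a = tau - a] expresses all the [tau^m B_a]
    through the [tau^m] and one of them, in a way that is polynomial in a;
    so for a generic a the set of the i with [E (t^i B_a) \in H] is an interval,
    and a long orbit leaves H at most once.  Write 1/d' as a multiple of
    [s - s'] with units s and s'.  If [E y = Q g_y d] is in H and y is typical, then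
    so are the N-fold multiples of [E (s y)] and [E (s' y)], and the difference
    of these two is, up to an integer factor, the plane vector y.  Applied to
    wy for a few more units w, this puts y z in H for any finite set of z
    prescribed in advance, with one unit y ([planar_saturation]).

    Dimension k.  Use the coordinate planes (0,1), (1,2), ... in turn.  The
    r-th step makes the images of the r-th coordinate components of all x in
    D periods, and later rotations do not move these components
    ([vanishing_step]).  At the end all the g x are periods. *)

(** * Subgroups and polynomials with values in a group *)

Section Subgroup.
Variables (V : zmodType) (H : pred V).
Hypothesis subH : zmod_closed H.

Lemma subgroup0 : 0 \in H. Proof. by case: subH. Qed.
Lemma subgroupB x y : x \in H -> y \in H -> x - y \in H.
Proof. by case: subH => _; apply. Qed.
Lemma subgroupN x : x \in H -> - x \in H.
Proof. by move=> Hx; rewrite -sub0r subgroupB ?subgroup0. Qed.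
Lemma subgroupD x y : x \in H -> y \in H -> x + y \in H.
Proof. by move=> Hx Hy; rewrite -[y]opprK subgroupB ?subgroupN. Qed.
Lemma subgroupMn x n : x \in H -> x *+ n \in H.
Proof.
by move=> Hx; elim: n => [|n IHn]; rewrite ?mulr0n ?subgroup0 // mulrS subgroupD.
Qed.
Lemma subgroupMn_dvd x m n : (m %| n)%N -> x *+ m \in H -> x *+ n \in H.
Proof. by move=> /dvdnP[k ->] Hx; rewrite mulnC mulrnA subgroupMn. Qed.

(** Polynomials are lists of coefficients, constant term first, evaluated at
    natural numbers: the coefficients lie in a group, not in a ring. *)
Fixpoint horner_nat (p : seq V) (a : nat) : V :=
  if p is c :: s then c + horner_nat s a *+ a else 0.

(** Synthetic division of [p] by [X - a0]: only the quotient, one term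
    shorter than [p]. *)
Fixpoint horner_quo (a0 : nat) (p : seq V) : seq V :=
  if p is c :: s then
    if s is _ :: _ then horner_nat s a0 :: horner_quo a0 s else [::]
  else [::].

Lemma size_horner_quo a0 p : size (horner_quo a0 p) = (size p).-1.
Proof. by elim: p => //= c [|d s] //= IHs; rewrite IHs. Qed.

(** This is [p a - p a0 = (a - a0) q a] written without subtraction, since
    [a - a0] may be negative. *)
Lemma horner_quoP a0 p a :
  horner_nat p a + horner_nat (horner_quo a0 p) a *+ a0 =
  horner_nat p a0 + horner_nat (horner_quo a0 p) a *+ a.
Proof.
have hornerE c s b : horner_nat (c :: s) b = c + horner_nat s b *+ b by [].
elim: p => [|c [|d s] IHs]; rewrite ?mul0rn //; first by rewrite /= !mul0rn.
rewrite -[horner_quo _ _]/(_ :: horner_quo a0 (d :: s)).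
rewrite !(hornerE c) (hornerE (horner_nat _ _)).
move: (horner_nat (d :: s) a) (horner_nat (d :: s) a0) IHs => u v.
move: (horner_nat (horner_quo a0 (d :: s)) a) => w IHs.
rewrite !mulrnDl -!addrA -(mulrnAC w); congr (_ + _).
by rewrite [in LHS]addrCA; congr (_ + _); rewrite -!mulrnDl IHs.
Qed.

Lemma horner_nat_scale p k a :
  horner_nat [seq c *+ k | c <- p] a = horner_nat p a *+ k.
Proof.
elim: p => [|c s IHs] /=; rewrite ?mul0rn // IHs mulrnDl -!mulrnA.
by rewrite (mulnC k).
Qed.

Lemma horner_quo_scale a0 p k :
  horner_quo a0 [seq c *+ k | c <- p] = [seq c *+ k | c <- horner_quo a0 p].
Proof.
elim: p => //= c [|d s] //= IHs; rewrite IHs; congr (_ :: _).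
exact: (horner_nat_scale (d :: s)).
Qed.

Lemma horner_quo_coef a0 p :
  horner_nat p a0 \in H -> {subset horner_quo a0 p <= H} -> {subset p <= H}.
Proof.
elim: p => //= c s IHs Hp Hq.
have [Hs0 Hs] : horner_nat s a0 \in H /\ {subset s <= H}.
  case: s IHs Hq {Hp} => [|d s] IHs Hq /=; first by rewrite subgroup0.
  have Hs0 : horner_nat (d :: s) a0 \in H by apply: Hq; rewrite inE eqxx.
  split=> //; apply: IHs => // x xq; apply: Hq.
  by rewrite inE xq orbT.
move=> x; rewrite inE => /orP[/eqP->|]; last exact: Hs.
by rewrite -[c](addrK (horner_nat s a0 *+ a0)) subgroupB ?subgroupMn.
Qed.

(** Modulo [H] a polynomial with more roots than its degree has zero
    coefficients, up to a factor that only depends on the number of the roots and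
    on a bound [M] for them: dividing out a root costs a difference of two roots,
    which divides [M!].  The same factor has to serve all subgroups [H] in
    [nearly_invariant]. *)
Lemma coef_in_subgroup (S : seq nat) (p : seq V) (M : nat) :
    uniq S -> (size p <= size S)%N -> {in S, forall a, (a <= M)%N} ->
    {in S, forall a, horner_nat p a \in H} ->
  {in p, forall c, c *+ (M`! ^ size S) \in H}.
Proof.
elim: S p => [|a0 S IHS] p /=.
  by rewrite leqn0 => _ /nilP-> _ _ c.
move=> /andP[a0S uS] le_pS leM Hp.
have Ha0 : horner_nat p a0 \in H by apply: Hp; rewrite inE eqxx.
have Hq : {in [seq c *+ M`! | c <- horner_quo a0 p],
            forall c, c *+ (M`! ^ size S) \in H}.
  apply: IHS => //.
  - by rewrite size_map size_horner_quo; case: (p) le_pS.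
  - by move=> a aS; apply: leM; rewrite inE aS orbT.
  move=> a aS; rewrite horner_nat_scale; set w := horner_nat _ a.
  have Ha : horner_nat p a \in H by apply: Hp; rewrite inE aS orbT.
  have neq_a : a != a0 by apply: contraNneq a0S => <-.
  have Hw : w *+ a - w *+ a0 \in H.
    have -> : w *+ a - w *+ a0 = horner_nat p a - horner_nat p a0.
      by apply/eqP; rewrite subr_eq addrAC horner_quoP addrAC subrr add0r.
    by rewrite subgroupB.
  have le_a : (a <= M)%N by apply: leM; rewrite inE aS orbT.
  have le_a0 : (a0 <= M)%N by apply: leM; rewrite inE eqxx.
  case: (ltngtP a a0) => [lt_a|lt_a|eq_a]; last by rewrite eq_a eqxx in neq_a.
  - apply: (@subgroupMn_dvd _ (a0 - a)); last first.
      by rewrite mulrnBr 1?ltnW // -opprB subgroupN.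
    by apply: dvdn_fact; rewrite subn_gt0 lt_a (leq_trans (leq_subr _ _)).
  - apply: (@subgroupMn_dvd _ (a - a0)); last by rewrite mulrnBr 1?ltnW.
    by apply: dvdn_fact; rewrite subn_gt0 lt_a (leq_trans (leq_subr _ _)).
move=> c cp; rewrite expnS.
set K := (_ * _)%N.
suff : {subset [seq c *+ K | c <- p] <= H} by apply; apply: map_f.
apply: (@horner_quo_coef a0).
  by rewrite horner_nat_scale subgroupMn.
rewrite horner_quo_scale => _ /mapP[d dq ->].
by rewrite mulrnA; apply: Hq; apply: map_f.
Qed.

(** The coefficients, as a polynomial in [a], of
    [x + sum_(i < l) a^i (e (n+i+1) - a e (n+i))]. *)
Fixpoint telescope_coef (e : nat -> V) (x : V) (n l : nat) : seq V :=
  if l is l'.+1 then x + e n.+1 :: telescope_coef e (- e n) n.+1 l' else [:: x].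

Lemma size_telescope_coef e x n l : size (telescope_coef e x n l) = l.+1.
Proof. by elim: l x n => //= l IHl x n; rewrite IHl. Qed.

(** For [b] as in the hypothesis the sum telescopes. *)
Lemma horner_telescope e (b : nat -> V) x n l a :
    (forall m, b m - b m.+1 *+ a = e m.+1 - e m *+ a) ->
  horner_nat (telescope_coef e x n l) a = x + b n - b (n + l)%N *+ (a ^ l).
Proof.
move=> eb; elim: l x n => [|l IHl] x n /=.
  by rewrite mul0rn addr0 addn0 addrK.
rewrite IHl mulrnBl mulrnDl addSnnS -mulrnA mulnC -expnS.
rewrite !addrA; congr (_ - _); rewrite -!addrA; congr (_ + _).
by rewrite addrA mulNrn -eb subrK.
Qed.

(** Suppose that [b a n] and [b a (n + l)] are in [H] for more than [l] values of
    [a].  By telescoping, a polynomial in [a] of degree [l], whose coefficients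
    do not depend on [a], takes values in [H] at all these [a], so its
    coefficients are in [H] up to a factor.  The first two coefficients,
    [e (n+1)] and [e (n+2) - e n], together with [b a n], determine
    [a^2 b a (n+2)]. *)
Lemma zero_set_convex (e : nat -> V) (b : nat -> nat -> V) (S : seq nat)
    (M n l : nat) :
    (forall a m, a \in S -> b a m - b a m.+1 *+ a = e m.+1 - e m *+ a) ->
    uniq S -> (1 < l < size S)%N -> {in S, forall a, 0 < a <= M}%N ->
    {in S, forall a, b a n \in H /\ b a (n + l)%N \in H} ->
  {in S, forall a, b a n.+2 *+ (M`! ^ (size S).+2) \in H}.
Proof.
move=> eb uS /andP[l_gt1 ltlS] leM Hb a aS.
have Hcoef : {in telescope_coef e 0 n l,
    forall c, c *+ (M`! ^ size S) \in H}.
  apply: coef_in_subgroup => //.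
  - by rewrite size_telescope_coef.
  - by move=> a' /leM /andP[].
  move=> a' a'S; rewrite (@horner_telescope _ (b a')); last by move=> m; apply: eb.
  by have [? ?] := Hb _ a'S; rewrite add0r subgroupB ?subgroupMn.
have Hsub : {subset telescope_coef e 0 n 2 <=
               [:: - e n.+1 & telescope_coef e 0 n l]}.
  case: l l_gt1 {ltlS Hb Hcoef} => [|[|l]] //= _ x.
  by rewrite !inE => /or3P[] ->; rewrite ?orbT.
have Hcoef2 : {in telescope_coef e 0 n 2, forall c, c *+ (M`! ^ size S) \in H}.
  move=> c /Hsub; rewrite inE => /orP[/eqP->|/Hcoef//].
  rewrite mulNrn subgroupN // Hcoef //; case: l l_gt1 {ltlS Hb Hcoef Hsub} => //=.
  by move=> l _; rewrite add0r inE eqxx.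
have /andP[a_gt0 le_aM] := leM a aS.
apply: (@subgroupMn_dvd _ (a ^ 2 * M`! ^ size S)).
  rewrite -[(size S).+2]addn2 expnD mulnC dvdn_mul // dvdn_exp2r //.
  by rewrite dvdn_fact ?a_gt0.
rewrite mulrnA -[in b a _]addn2 -[_ *+ a ^ 2](subKr (0 + b a n)).
rewrite -(@horner_telescope e (b a)); last by move=> m; apply: eb.
rewrite mulrnBl subgroupB //.
  by rewrite add0r subgroupMn; case: (Hb _ aS).
rewrite -horner_nat_scale; set p := telescope_coef _ _ _ _ in Hcoef2 *.
elim: p Hcoef2 => /= [|c p IHp] Hp; first by rewrite subgroup0.
apply: subgroupD; first by rewrite Hp // inE eqxx.
apply: subgroupMn; apply: IHp => d dp.
by rewrite Hp // inE dp orbT.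
Qed.

End Subgroup.

(** * Sets of units that are nearly invariant under a rotation *)

(** A set with s elements has at least [s - 1] pairs. *)
Lemma sum_le_pairs (f : nat -> bool) L :
  (\sum_(i < L) f i <= 1 + \sum_(j < L) \sum_(i < j) (f i && f j))%N.
Proof.
elim: L => [|L IHL]; first by rewrite !big_ord0.
rewrite !big_ord_recr /=; case fL: (f L); last first.
  by rewrite addn0 (leq_trans IHL) // addnA leq_addr.
under [X in (_ + (_ + X))%N]eq_bigr do rewrite andbT.
case: (posnP (\sum_(i < L) f i)) => [->|pos]; first by rewrite add0n leq_addr.
by rewrite addnA leq_add.
Qed.

(** Affine, not additive, maps are needed because a rotation of one plane leaves
    fixed the component of a vector orthogonal to that plane. *)
Definition affine (C V : zmodType) (E : C -> V) :=
  forall x y z, E (x - y + z) = E x - E y + E z.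

(** An affine map respects integer relations whose coefficients have sum 0;
    the relation between Blaschke factors is of this kind because all of them
    take the value 1 at 1. *)
Lemma affine_relation (C V : zmodType) (E : C -> V) x y z w a :
  affine E -> x - y *+ a = z - w *+ a -> E x - E y *+ a = E z - E w *+ a.
Proof.
move=> affE eq_xyzw; pose D u := E u - E 0.
have DB u v : D (u - v) = D u - D v.
  by rewrite /D -{1}[u - v]addr0 affE addrK opprB addrA subrK.
have D0 : D 0 = 0 by rewrite /D subrr.
have DN u : D (- u) = - D u by rewrite -[- u]add0r DB D0 add0r.
have DD u v : D (u + v) = D u + D v by rewrite -{1}[v]opprK DB DN opprK.
have DMn u k : D (u *+ k) = D u *+ k.
  elim: k => [|k IHk]; first by rewrite !mulr0n D0.
  by rewrite !mulrS DD IHk.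
have ED u : E u = D u + E 0 by rewrite subrK.
clearbody D; rewrite (ED x) (ED y) (ED z) (ED w) !mulrnDl -!DMn !opprD.
have D' u v : D u + E 0 + (- D v - E 0 *+ a) = D (u - v) + (E 0 - E 0 *+ a).
  by rewrite DB addrACA.
by rewrite !D' eq_xyzw.
Qed.

Section UnitCircle.
Variable C : numClosedFieldType.
Implicit Types (t : C) (Y Z : seq C).

(** For every subgroup [H], at most one m-th of the elements of [Y] are in [H]
    and leave it under multiplication by [t].  The factor [N] absorbs torsion
    modulo [H]; it is chosen before [H]. *)
Definition nearly_invariant (t : C) (m N : nat) (Y : seq C) :=
  forall (V : zmodType) (H : pred V) (E : C -> V),
    zmod_closed H -> affine E ->
  (m * count (fun y => (E y \in H) && (E (t * y)%R *+ N \notin H)) Y <= size Y)%N.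

Definition blaschke (a : nat) (tau : C) : C := (tau - a%:R) / (1 - tau *+ a).

Lemma blaschke_denom_neq0 a (tau : C) : `|tau| = 1 -> (1 < a)%N -> 1 - tau *+ a != 0.
Proof.
move=> tau1 a_gt1; rewrite subr_eq0; apply/eqP=> /(congr1 Num.norm)/eqP.
by rewrite normrMn normr1 tau1 eq_sym pnatr_eq1 gtn_eqF.
Qed.

Lemma blaschke_norm a (tau : C) : `|tau| = 1 -> (1 < a)%N -> `|blaschke a tau| = 1.
Proof.
move=> tau1 a_gt1; have nz := blaschke_denom_neq0 tau1 a_gt1.
have tau_nz : tau != 0 by rewrite -normr_eq0 tau1 oner_eq0.
rewrite normf_div; suff -> : `|tau - a%:R| = `|1 - tau *+ a|.
  by rewrite divff ?normr_eq0.
have -> : 1 - tau *+ a = tau * (tau - a%:R)^*.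
  by rewrite rmorphB rmorph_nat mulrBr -normCK tau1 expr1n mulr_natr.
by rewrite normrM tau1 mul1r norm_conjC.
Qed.

Lemma blaschkeE a (tau : C) : `|tau| = 1 -> (1 < a)%N ->
  blaschke a tau - (tau * blaschke a tau) *+ a = tau - 1 *+ a.
Proof.
move=> tau1 a_gt1; have nz := blaschke_denom_neq0 tau1 a_gt1.
by rewrite -mulrnAl -[X in X - _]mul1r -mulrBl mulrC /blaschke divfK.
Qed.

(** For [tau^2 = t] and each [a], consider the orbit
    [t^i B_a = tau^(2i) B_a], [i < L].  If it leaves [H] twice, at i and at j,
    then [zero_set_convex] applies with [l = 2 (j - i)], so each pair (i, j) can
    occur for at most [2 L] values of [a].  With [A = 2 L^3] values of [a] these
    exceptions are at most [A] in number, and so are the first exits of the [A]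
    orbits: [2 A] exits in all among [A L] elements, and [L >= 2 m]. *)
Lemma nearly_invariant_exists t m : `|t| = 1 ->
  exists Y N, [/\ Y != [::], {in Y, forall y, `|y| = 1}, (0 < N)%N
    & nearly_invariant t m N Y].
Proof.
move=> t1; pose tau := sqrtC t.
have tau1 : `|tau| = 1.
  by apply/eqP; rewrite -(@pexpr_eq1 _ _ 2) // -normrX sqrtCK t1.
have [L leL L_gt0] : exists2 L, (2 * m <= L)%N & (0 < L)%N by exists (2 * m).+1.
pose A := (2 * L ^ 3)%N.
pose yy a i := tau ^+ (2 * i) * blaschke a tau.
pose M := A.+1; pose N := (M`! ^ A.+2)%N.
have in_iota a : a \in iota 2 A -> (1 < a <= M)%N by rewrite mem_iota ltnS.
exists [seq yy a i | a <- iota 2 A, i <- iota 0 L], N.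
have sizeY : size [seq yy a i | a <- iota 2 A, i <- iota 0 L] = (A * L)%N.
  by rewrite size_allpairs !size_iota.
split.
- by rewrite -size_eq0 sizeY -lt0n /A !muln_gt0 L_gt0.
- move=> _ /allpairsP[[a i] [/= /in_iota /andP[a_gt1 _] _ ->]].
  by rewrite normrM normrX tau1 expr1n mul1r blaschke_norm.
- by rewrite expn_gt0 fact_gt0.
move=> V H E subH affE; rewrite sizeY.
set bad := fun y => _ && _; pose f a i := bad (yy a i).
have -> : count bad [seq yy a i | a <- iota 2 A, i <- iota 0 L] =
    (\sum_(a <- iota 2 A) \sum_(i < L) f a i)%N.
  rewrite -sum1_count big_mkcond big_allpairs_dep /=; apply: eq_bigr => a _.
  rewrite -{1}[L]subn0 -/(index_iota 0 L) big_mkord; apply: eq_bigr => i _.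
  by rewrite /f; case: (bad _).
have few_a (i j : nat) : (i < j < L)%N ->
    (\sum_(a <- iota 2 A) (f a i && f a j) <= 2 * L)%N.
  move=> /andP[ltij ltjL]; rewrite leqNgt; apply/negP.
  have -> : (\sum_(a <- iota 2 A) (f a i && f a j) =
      size [seq a <- iota 2 A | f a i && f a j])%N.
    by rewrite size_filter -sum1_count [RHS]big_mkcond.
  set S := [seq _ <- _ | _] => ltLS.
  have SP a : a \in S -> [/\ (1 < a <= M)%N, f a i & f a j].
    by rewrite mem_filter => /andP[/andP[-> ->] /in_iota].
  have : has predT S by case: (S) ltLS.
  case/hasP=> a aS _; have [_ fai _] := SP a aS.
  have /andP[_ /negP[]] := fai.
  have -> : t * yy a i = tau ^+ (2 * i).+2 * blaschke a tau.
    by rewrite mulrA -[t]sqrtCK -exprD add2n.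
  pose b a m := E (tau ^+ m * blaschke a tau).
  have := @zero_set_convex V H subH (fun m => E (tau ^+ m)) b S M (2 * i)
    (2 * (j - i)).
  move=> /(_ _ _ _ _ _ a aS) zs; apply: subgroupMn_dvd (zs _ _ _ _ _) => //.
  - by rewrite dvdn_exp2l // !ltnS size_filter (leq_trans (count_size _ _)) ?size_iota.
  - move=> a' k a'S; have [/andP[a'_gt1 _] _ _] := SP a' a'S.
    apply: affine_relation => //.
    rewrite exprSr -mulrA -mulrnAr -mulrBr blaschkeE //.
    by rewrite mulrBr mulrnAr mulr1.
  - by rewrite filter_uniq ?iota_uniq.
  - rewrite (leq_ltn_trans _ ltLS); first by rewrite andbT; lia.
    by rewrite leq_mul2l leq_subLR ltnW // ltn_addl.
  - by move=> a' /SP[/andP[/ltnW -> ->]].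
  move=> a' a'S; have [_ /andP[Ha'i _] /andP[Ha'j _]] := SP a' a'S.
  by rewrite /b -mulnDr subnKC 1?ltnW.
suff le_sum : (\sum_(a <- iota 2 A) \sum_(i < L) f a i <= 2 * A)%N.
  apply: leq_trans (leq_mul (leqnn m) le_sum) _.
  by rewrite mulnCA mulnA mulnC leq_mul2l leL orbT.
apply: (@leq_trans (\sum_(a <- iota 2 A)
    (1 + \sum_(j < L) \sum_(i < j) (f a i && f a j)))).
  by apply: leq_sum => a _; apply: sum_le_pairs.
rewrite big_split /= sum1_size size_iota mul2n -addnn leq_add2l.
rewrite exchange_big /=.
apply: (@leq_trans (\sum_(j < L) \sum_(i < L) (2 * L))).
  apply: leq_sum => j _; rewrite exchange_big /=.
  apply: (@leq_trans (\sum_(i < j) (2 * L))).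
    by apply: leq_sum => i _; apply: few_a; rewrite !ltn_ord.
  by rewrite !sum_nat_const !card_ord leq_mul2r ltnW ?orbT.
rewrite !sum_nat_const !card_ord /A; lia.
Qed.

Lemma affine_mull (V : zmodType) (E : C -> V) z :
  affine E -> affine (fun y => E (z * y)).
Proof. by move=> affE x y w; rewrite mulrDr mulrBr affE. Qed.

Lemma nearly_invariant_dvd t m N N' Y : (N %| N')%N ->
  nearly_invariant t m N Y -> nearly_invariant t m N' Y.
Proof.
move=> dvdN nearY V H E subH affE; apply: leq_trans (nearY V H E subH affE).
rewrite leq_mul2l; apply/orP; right; apply: sub_count => y /= /andP[->].
by apply: contra; apply: subgroupMn_dvd.
Qed.

Lemma count_mulC (p : pred C) Y Z :
  count p [seq z * y | z <- Z, y <- Y] = count p [seq y * z | y <- Y, z <- Z].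
Proof.
rewrite -!sum1_count big_mkcond [RHS]big_mkcond !big_allpairs_dep exchange_big /=.
by apply: eq_bigr => y _; apply: eq_bigr => z _; rewrite mulrC.
Qed.

Lemma nearly_invariant_mull t m N Y Z : nearly_invariant t m N Y ->
  nearly_invariant t m N [seq z * y | z <- Z, y <- Y].
Proof.
move=> nearY V H E subH affE; elim: Z => [|z Z IHZ] //=; first by rewrite muln0.
rewrite count_cat size_cat mulnDr leq_add // count_map size_map.
have := nearY V H _ subH (affine_mull z affE).
by under eq_count do rewrite mulrCA.
Qed.

Lemma nearly_invariant_mulr t m N Y Z : nearly_invariant t m N Y ->
  nearly_invariant t m N [seq y * z | y <- Y, z <- Z].
Proof.
move=> nearY V H E subH affE; rewrite -count_mulC size_allpairs [(_ Y * _)%N]mulnC.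
by rewrite -(size_allpairs (fun z y => z * y)); apply: nearly_invariant_mull.
Qed.

(** The set of products of a set nearly invariant under [t] with any other set
    is nearly invariant under [t], so one set serves finitely many [t]. *)
Lemma nearly_invariant_all (T : seq C) m : {in T, forall t, `|t| = 1} ->
  exists Y N, [/\ Y != [::], {in Y, forall y, `|y| = 1}, (0 < N)%N
    & {in T, forall t, nearly_invariant t m N Y}].
Proof.
elim: T => [|t T IHT] T1.
  by exists [:: 1], 1%N; split=> // y; rewrite inE => /eqP->; rewrite normr1.
have [|Z [NZ [Z_neq0 Z1 NZ_gt0 nearZ]]] := IHT.
  by move=> t' t'T; rewrite T1 // inE t'T orbT.
have [|Y [NY [Y_neq0 Y1 NY_gt0 nearY]]] := @nearly_invariant_exists t m.
  by rewrite T1 // inE eqxx.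
exists [seq z * y | z <- Z, y <- Y], (NZ * NY)%N; split.
- by rewrite -size_eq0 size_allpairs muln_eq0 !size_eq0 negb_or Z_neq0.
- by move=> _ /allpairsP[[z y] [/= /Z1 z1 /Y1 y1 ->]]; rewrite normrM z1 y1 mulr1.
- by rewrite muln_gt0 NZ_gt0.
move=> t'; rewrite inE => /predU1P[->|t'T].
- apply: nearly_invariant_mull; apply: nearly_invariant_dvd nearY.
  exact: dvdn_mull.
apply: nearly_invariant_mulr; apply: nearly_invariant_dvd (nearZ _ t'T).
exact: dvdn_mulr.
Qed.

(** The union bound: the sets [bad i] do not cover [Y]. *)
Lemma avoid_rare (I T : eqType) (s : seq I) (bad : I -> pred T) (Y : seq T) m :
    Y != [::] -> (size s < m)%N ->
    {in s, forall i, m * count (bad i) Y <= size Y}%N ->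
  exists2 y, y \in Y & {in s, forall i, ~~ bad i y}.
Proof.
move=> Y_neq0 lt_sm rare; have Y_gt0 : (0 < size Y)%N by rewrite lt0n size_eq0.
pose any y := has (bad^~ y) s.
have le_any : (m * count any Y <= size s * size Y)%N.
  rewrite /any; elim: s rare {lt_sm any} => [|i s IHs] rare /=.
    by rewrite count_pred0 muln0.
  apply: (@leq_trans (m * (count (bad i) Y + count (fun y => has (bad^~ y) s) Y))).
    by rewrite leq_mul2l -count_predUI leq_addr orbT.
  rewrite mulnDr mulSn leq_add //; first by rewrite rare // inE eqxx.
  by apply: IHs => j js; rewrite rare // inE js orbT.
have : (count any Y < size Y)%N.
  rewrite -(ltn_pmul2l (leq_ltn_trans (leq0n _) lt_sm)).
  by rewrite (leq_ltn_trans le_any) // ltn_pmul2r.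
rewrite -(count_predC any) -[X in (X < _)%N]addn0 ltn_add2l -has_count.
case/hasP=> y yY /hasPn nobad; exists y => //.
Qed.

(** A vector of length at most 2 is the sum of the two sides of a rhombus with
    unit sides of which it is a diagonal. *)
Lemma sum_two_units (c : C) : `|c| <= 2%:R ->
  exists s s' : C, [/\ `|s| = 1, `|s'| = 1 & c = s + s'].
Proof.
move=> c_le2; have [-> | c_neq0] := eqVneq c 0.
  by exists 1, (-1); rewrite normrN normr1 subrr.
have nc_gt0 : 0 < `|c| by rewrite normr_gt0.
pose r := `|c| / 2%:R; pose d := sqrtC (1 - r ^+ 2); pose w := c / `|c|.
have r_ge0 : 0 <= r by rewrite divr_ge0.
have r_real : r \is Num.real by rewrite ger0_real.
have w1 : `|w| = 1 by rewrite normf_div normr_id divff // gt_eqF.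
have d_ge0 : 0 <= d.
  by rewrite sqrtC_ge0 subr_ge0 expr_le1 // ler_pdivrMr ?ltr0n // mul1r.
have unit1 (e : C) : e \is Num.real -> e ^+ 2 = d ^+ 2 -> `|w * (r + 'i * e)| = 1.
  move=> e_real e2; rewrite normrM w1 mul1r; apply/eqP.
  rewrite -(@pexpr_eq1 _ _ 2) // normC2_rect // e2 sqrtCK.
  by rewrite addrC subrK.
exists (w * (r + 'i * d)), (w * (r + 'i * - d)); split.
- by rewrite unit1 ?ger0_real.
- by rewrite unit1 ?sqrrN ?rpredN ?ger0_real.
rewrite -mulrDr mulrN addrACA subrr addr0 -mulr2n -mulr_natr divfK ?pnatr_eq0 //.
by rewrite divfK ?gt_eqF.
Qed.

End UnitCircle.

(** * Saturation of a subgroup by the rotations of one plane *)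

Section Planar.
Variable R : realType.
Local Notation C := R[i].

Lemma multiple_of_two_units (c : C) :
  exists M : nat * (C * C),
    [/\ `|M.2.1| = 1, `|M.2.2| = 1 & c = (M.2.1 + M.2.2) *+ M.1].
Proof.
pose M := (Num.truncn (Num.sqrt (complex.Re c ^+ 2 + complex.Im c ^+ 2))).+1.
have M_neq0 : M%:R != 0 :> C by rewrite pnatr_eq0.
have [|s [s' [s1 s'1 cE]]] := @sum_two_units C (c / M%:R).
  rewrite normf_div normr_nat ler_pdivrMr ?ltr0n //.
  rewrite -natrM normc_def -(rmorph_nat (real_complex R)) lecR.
  apply: ltW; apply: lt_le_trans (truncnS_gt _) _.
  by rewrite ler_nat leq_pmull.
by exists (M, (s, s')); split=> //=; rewrite -cE -[RHS]mulr_natr divfK.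
Qed.

(** The order of the choices matters: the number of conditions, which fixes
    [m], depends only on the sizes of [s] and [P]; then come the set [Y] and the
    factor [N]; and only then the units [w], chosen with
    [z = N M (w + w')], to undo the factor [N]. *)
Lemma planar_saturation (I : eqType) (s : seq I) (p : I -> C) (P : seq C) :
    {in s, forall i, p i != 0} ->
  exists U : seq C, {in U, forall u, `|u| = 1} /\
    forall (V : zmodType) (H : pred V) (J : {additive C -> V}) (q : I -> V),
      zmod_closed H ->
      {in U, forall u, exists2 i, i \in s & J (u * p i) + q i \in H} ->
    exists2 y, `|y| = 1 & {in P, forall z, J (z * y) \in H}.
Proof.
move=> p_neq0; have /choice[dec decP] := multiple_of_two_units.
pose half1 c := (dec c).2.1; pose half2 c := (dec c).2.2.
(* The units s and s' with (p i)^-1 a multiple of s - s'. *)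
pose T := [seq half1 (p i)^-1 | i <- s] ++ [seq - half2 (p i)^-1 | i <- s].
have T1 : {in T, forall t, `|t| = 1}.
  move=> t; rewrite mem_cat => /orP[]/mapP[i _ ->].
    by rewrite /half1; case: (decP (p i)^-1).
  by rewrite normrN /half2; case: (decP (p i)^-1).
pose m := ((size P + size P) * size [seq (i, t) | i <- s, t <- T]).+1.
have [Y [N [Y_neq0 Y1 N_gt0 nearY]]] := nearly_invariant_all m T1.
(* The units w and w' with z a multiple of N (w + w'). *)
pose W := [seq half1 (z / N%:R) | z <- P] ++ [seq half2 (z / N%:R) | z <- P].
have W1 : {in W, forall w, `|w| = 1}.
  move=> w; rewrite mem_cat /half1 /half2 => /orP[]/mapP[z _ ->];
  by case: (decP (z / N%:R)).
exists [seq w * y | w <- W, y <- Y]; split.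
  by move=> _ /allpairsP[[w y] [/= /W1 w1 /Y1 y1 ->]]; rewrite normrM w1 y1 mulr1.
move=> V H J q subH cover.
pose E i u := J (u * p i) + q i.
have affE i : affine (E i).
  move=> x y z; rewrite /E mulrDl mulrBl raddfD raddfB.
  by rewrite [J (y * p i) + q i]addrC addrKA addrA.
pose bad (c : C * (I * C)) (y : C) :=
  (E c.2.1 (c.1 * y) \in H) && (E c.2.1 (c.1 * (c.2.2 * y)) *+ N \notin H).
pose conds := [seq (w, c) | w <- W, c <- [seq (i, t) | i <- s, t <- T]].
have [||y yY good] := @avoid_rare _ _ conds bad Y m Y_neq0.
- by rewrite size_allpairs size_cat !size_map ltnS.
- move=> _ /allpairsP[[w c] [/= _ /allpairsP[[i t] [/= _ tT ->]] ->]].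
  exact: nearY t tT V H _ subH (affine_mull w (affE i)).
have HN w : w \in W -> J (w * y) *+ N \in H.
  move=> wW; have [|i si HE] := cover (w * y).
    by apply/allpairsP; exists (w, y).
  have HT t : t \in T -> E i (w * (t * y)) *+ N \in H.
    move=> tT; have := good (w, (i, t)).
    rewrite /bad /= HE negbK; apply; apply/allpairsP; exists (w, (i, t)).
    by split=> //; apply/allpairsP; exists (i, t).
  have [_ _ pE] := decP (p i)^-1.
  have T_half1 : half1 (p i)^-1 \in T.
    by rewrite mem_cat; apply/orP; left; apply/mapP; exists i.
  have T_half2 : - half2 (p i)^-1 \in T.
    by rewrite mem_cat; apply/orP; right; apply/mapP; exists i.
  have := subgroupB subH (HT _ T_half1) (HT _ T_half2).
  rewrite -mulrnBl /E [X in _ - X]addrC addrKA -raddfB.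
  move=> /(subgroupMn subH (dec (p i)^-1).1); rewrite mulrnAC -(raddfMn J).
  rewrite (_ : (_ - _) *+ _ = w * y) //; have := divff (p_neq0 i si).
  rewrite /half1 /half2; move: pE; case: (dec _) => M1 [h h'] /= -> pK.
  by rewrite -[RHS]mulr1 -pK {pK}; ring.
exists y; first exact: Y1.
move=> z zP; have [_ _ zE] := decP (z / N%:R).
have -> : z = (half1 (z / N%:R) + half2 (z / N%:R)) *+ N *+ (dec (z / N%:R)).1.
  by rewrite -mulrnA mulnC mulrnA -zE -[RHS]mulr_natr divfK // pnatr_eq0 -lt0n.
rewrite mulrnAl raddfMn subgroupMn // mulrnAl raddfMn mulrDl raddfD mulrnDl.
by rewrite subgroupD // HN // mem_cat; apply/orP; [left|right];
   apply/mapP; exists z.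
Qed.

End Planar.

(** * Dilation of tiles *)

Section Dilation.
Variable V : zmodType.
Implicit Types (X : seq V) (t : V).

Definition sum_shift (R : nmodType) X (f : V -> R) t := \sum_(x <- X) f (t + x).

(** The binomial formula for the sum of two commuting shift operators. *)
Lemma iter_sum_shift_cons (R : nmodType) x X (f : V -> R) m t :
  iter m (sum_shift (x :: X)) f t =
  \sum_(i < m.+1) iter (m - i) (sum_shift X) f (t + x *+ i) *+ 'C(m, i).
Proof.
elim: m t => [|m IHm] t; first by rewrite big_ord_recl big_ord0 /= !addr0.
rewrite iterS {1}/sum_shift big_cons IHm.
under [X in _ + X]eq_bigr do rewrite IHm.
pose a i := iter (m.+1 - i) (sum_shift X) f (t + x *+ i).
rewrite (eq_bigr (fun i : 'I_m.+1 => a i.+1 *+ 'C(m, i))); last first.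
  by move=> i _; rewrite /a subSS mulrS addrA.
rewrite exchange_big /= [X in _ + X](eq_bigr (fun i : 'I_m.+1 =>
  a i *+ 'C(m, i))); last first.
  move=> i _; rewrite sumrMnl /a subSn -1?ltnS // iterS; congr (_ *+ _).
  by apply: eq_bigr => y _; rewrite addrAC.
rewrite -[RHS]/(\sum_(i < m.+2) a i *+ 'C(m.+1, i)) [RHS]big_ord_recl.
rewrite [X in _ + X = _]big_ord_recl !bin0 addrCA; congr (_ + _).
under [RHS]eq_bigr do rewrite binS mulrnDr.
rewrite big_split addrC /=; congr (_ + _).
by rewrite [RHS]big_ord_recr /= bin_small // mulr0n addr0.
Qed.

Lemma frobenius_shift (R : nzRingType) p X (f : V -> R) t :
    p \in [pchar R] ->
  iter p (sum_shift X) f t = \sum_(x <- X) f (t + x *+ p).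
Proof.
move=> pcharRp; have p_pr := pcharf_prime pcharRp.
case: p => // p in pcharRp p_pr *.
elim: X t => [|x X IHX] t; first by rewrite iterS /sum_shift !big_nil.
rewrite iter_sum_shift_cons big_ord_recl big_cons subn0 mulr0n addr0 bin0 mulr1n.
rewrite IHX addrC; congr (_ + _); rewrite big_ord_recr big1 /= => [|i _].
  by rewrite add0r subnn binn.
have /dvdnP[c ->] : (p.+1 %| 'C(p.+1, bump 0 i))%N.
  by apply: prime_dvd_bin => //=; rewrite /bump ltnS ltn_ord.
by rewrite mulrnA mulrn_pchar.
Qed.

Definition tiles X (f : V -> bool) := forall t, (\sum_(x <- X) f (t + x)%R = 1)%N.

(** The [p]-fold iterate of the sum of the shifts of [f] is the constant
    [n^(p-1)], which is 1 modulo [p] by the little theorem of Fermat, while by the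
    Frobenius identity it is the sum over the dilated set modulo [p].  The latter
    sum is at most [n < p]. *)
Lemma tiles_dilate_prime X f p : prime p -> (size X < p)%N -> tiles X f ->
  tiles [seq x *+ p | x <- X] f.
Proof.
move=> p_pr lt_Xp tileX t; rewrite big_map.
pose F s : 'F_p := (f s)%:R.
have SF s : sum_shift X F s = 1 by rewrite /sum_shift -natr_sum tileX.
have iterF m s : iter m.+1 (sum_shift X) F s = (size X ^ m)%:R.
  elim: m s => [|m IHm] s; first by rewrite /= SF.
  rewrite iterS /sum_shift; under eq_bigr do rewrite -/(sum_shift X) IHm.
  by rewrite big_const_seq count_predT iter_addr_0 -mulrnA -expnSr.
have X_gt0 : (0 < size X)%N.
  by have := tileX 0; case: (X) => //; rewrite big_nil.
have Xm : (size X ^ p.-1)%:R = 1 :> 'F_p.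
  have nX : (size X)%:R != 0 :> 'F_p.
    by rewrite -(dvdn_pcharf (pchar_Fp p_pr)) gtnNdvd.
  apply: (mulfI nX); rewrite mulr1 -natrM -expnS prednK ?prime_gt0 //.
  apply: val_inj; rewrite /= !val_Fp_nat //; exact: fermat_little.
have := frobenius_shift X F t (pchar_Fp p_pr).
rewrite -[X in iter X](prednK (prime_gt0 p_pr)) iterF Xm -natr_sum.
set S := (\sum_(x <- X) _)%N => eqS.
have leS : (S < p)%N.
  apply: leq_ltn_trans lt_Xp; rewrite /S -sum1_size leq_sum // => x _.
  by case: (f _).
have : (1%:R : 'F_p) = (S%:R : 'F_p) :> nat by rewrite -eqS.
rewrite !val_Fp_nat //.
by rewrite (modn_small leS) modn_small ?prime_gt1 // => <-.
Qed.

Lemma tiles_dilate X f r : (0 < r)%N ->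
    (forall p, prime p -> p %| r -> size X < p)%N -> tiles X f ->
  tiles [seq x *+ r | x <- X] f.
Proof.
elim/ltn_ind: r X => r IHr X r_gt0 big_p tileX.
have [r_le1 | r_gt1] := leqP r 1.
  have -> : r = 1%N by apply/eqP; rewrite eqn_leq r_le1.
  by rewrite map_id_in // => x _; rewrite mulr1n.
have p_pr := pdiv_prime r_gt1; have /dvdnP[q rE] := pdiv_dvd r.
have q_gt0 : (0 < q)%N by move: r_gt0; rewrite {1}rE muln_gt0 => /andP[].
have -> : [seq x *+ r | x <- X] =
    [seq x *+ q | x <- [seq x *+ pdiv r | x <- X]].
  by rewrite -map_comp; apply: eq_map => x /=; rewrite {1}rE mulnC mulrnA.
apply: IHr => //.
- by rewrite [X in (_ < X)%N]rE ltn_Pmulr ?prime_gt1.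
- by move=> p p_pr' dvd_pq; rewrite size_map big_p // rE dvdn_mulr.
by apply: tiles_dilate_prime => //; apply: big_p => //; apply: pdiv_dvd.
Qed.

Lemma tiles_dilate_fact X f j : tiles X f ->
  tiles [seq x *+ (1 + j * (size X)`!) | x <- X] f.
Proof.
apply: tiles_dilate => // p p_pr dvd_p; rewrite ltnNge; apply/negP => le_pX.
move: dvd_p; rewrite dvdn_addl ?dvdn_mull ?dvdn_fact ?prime_gt0 //.
by rewrite dvdn1 => /eqP p1; rewrite p1 in p_pr.
Qed.

End Dilation.

(** * Difference operators and periods *)

Section Differences.
Variable V : zmodType.
Implicit Types (h : V -> int) (v t : V).

Definition diff h v t := h (t + v) - h t.
Definition period h v := forall t, h (t + v) = h t.

Lemma period_zmod_closed h : zmod_closed [pred v | `[< period h v >]].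
Proof.
split=> [|u v]; rewrite !inE; first by move=> t; rewrite addr0.
by move=> hu hv t; rewrite -hv addrA subrK hu.
Qed.

Lemma period_diff h u v : period h v -> period (diff h u) v.
Proof. by move=> hv t; rewrite /diff hv -[in LHS]addrA [v + u]addrC addrA hv. Qed.

(** If [e] is the step of the first term, subtracting the relation for [j + 1]
    at [t] from the relation for [j] at [t + e] removes that term and replaces
    [h] by its difference along [e]; the relations keep their shape. *)
Lemma eliminate (Fs : seq (V * (V -> int))) h :
    (forall j t, h t + \sum_(F <- Fs) F.2 (t + F.1 *+ j) = 0) ->
  foldl diff h [seq F.1 | F <- Fs] =1 fun=> 0.
Proof.
have [n] := ubnP (size Fs); elim: n Fs h => // n IHn [|[e f] Fs] h lt_n hP t /=.
  by have := hP 0%N t; rewrite big_nil addr0.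
pose Fs' := [seq (F.1, fun t => F.2 (t + e) - F.2 (t + F.1)) | F <- Fs].
have -> : [seq F.1 | F <- Fs] = [seq F.1 | F <- Fs'] by rewrite -map_comp.
apply: IHn; first by rewrite size_map.
move=> j {}t; rewrite big_map sumrB /= /diff.
have := hP j.+1 t; rewrite big_cons /= => /eqP; rewrite addr_eq0 => /eqP->.
have := hP j (t + e); rewrite big_cons /= => /eqP; rewrite addr_eq0 => /eqP->.
rewrite mulrS !addrA.
set S1 := (X in - (_ + X) - _); set S2 := (X in _ - - (_ + X)).
set S1' := \sum_(F <- Fs) _; set S2' := \sum_(F <- Fs) _.
have -> : S1' = S1 by apply: eq_bigr => F _; rewrite addrAC.
have -> : S2' = S2 by apply: eq_bigr => F _; rewrite mulrSr addrA.
by ring.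
Qed.

(** Induction on the number of factors: [diff h v] is in the class and killed by
    the remaining factors, so it is 0, and [v] is a period of [h]. *)
Lemma diff_product_eq0 (P : (V -> int) -> Prop) (vs : seq V) h :
    (forall h v, P h -> P (diff h v)) ->
    (forall h v, P h -> v \in vs -> period h v -> h =1 fun=> 0) ->
  P h -> foldl diff h vs =1 (fun=> 0) -> h =1 fun=> 0.
Proof.
move=> Pdiff; elim: vs h => //= v vs IHvs h P0 Ph foldl0.
apply: (P0 h v) => //; first by rewrite inE eqxx.
move=> t; apply/eqP; rewrite -subr_eq0; apply/eqP; move: t.
apply: (IHvs (diff h v)) => //; last exact: Pdiff.
by move=> h' v' Ph' v'vs; apply: P0 => //; rewrite inE v'vs orbT.
Qed.

(** This plays the role of passing to a prime ideal: if products of difference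
    operators kill all functions of a class closed under differences, it is
    enough to treat the functions killed by one factor of each product. *)
Lemma branch_on_periods (P : (V -> int) -> Prop) (L : seq (seq V)) :
    (forall h v, P h -> P (diff h v)) ->
    (forall h vs, P h -> vs \in L -> foldl diff h vs =1 fun=> 0) ->
    (forall h, P h -> {in L, forall vs, exists2 v, v \in vs & period h v} ->
       h =1 fun=> 0) ->
  forall h, P h -> h =1 fun=> 0.
Proof.
move=> Pdiff; elim: L => [|vs L IHL] PL P0; first by move=> h Ph; apply: P0.
apply: IHL => [h vs' Ph vs'L|h Ph perL].
  by apply: PL => //; rewrite inE vs'L orbT.
pose P' h := P h /\ {in L, forall vs, exists2 v, v \in vs & period h v}.
apply: (@diff_product_eq0 P' vs) => //.
- move=> h' v [Ph' per']; split; first exact: Pdiff.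
  by move=> ws /per'[w ww hw]; exists w => //; apply: period_diff.
- move=> h' v [Ph' per'] vvs hv; apply: P0 => // ws; rewrite inE.
  by move=> /predU1P[->|/per'//]; exists v.
by apply: PL => //; rewrite inE eqxx.
Qed.

End Differences.

Arguments diff {V} h v t.

(** * Orthogonal maps *)

Section Orthogonal.
Variables (R : realType) (k : nat).
Implicit Types (x y w d t : 'rV[R]_k) (g : 'rV[R]_k -> 'rV[R]_k).

Definition dot x y : R := \sum_(i < k) x ord0 i * y ord0 i.

Lemma dotBl x y w : dot (x - y) w = dot x w - dot y w.
Proof. by rewrite -sumrB; apply: eq_bigr => i _; rewrite !mxE mulrBl. Qed.

Lemma dotZl (a : R) x w : dot (a *: x) w = a * dot x w.
Proof. by rewrite mulr_sumr; apply: eq_bigr => i _; rewrite mxE mulrA. Qed.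

Lemma dotC x y : dot x y = dot y x.
Proof. by apply: eq_bigr => i _; rewrite mulrC. Qed.

Definition orthogonal_map g :=
  [/\ zmod_morphism g, forall x, dot (g x) (g x) = dot x x & bijective g].

Lemma orthogonal_id : orthogonal_map id.
Proof. by split=> //; exists id. Qed.

Lemma orthogonal_comp g g' :
  orthogonal_map g -> orthogonal_map g' -> orthogonal_map (g \o g').
Proof.
move=> [addg dotg bijg] [addg' dotg' bijg']; split=> [x y|x|] /=.
- by rewrite addg' addg.
- by rewrite dotg.
exact: bij_comp.
Qed.

Lemma orthogonal_isometry g t :
  orthogonal_map g -> euclidean_isometry (fun x => t + g x).
Proof.
move=> [addg dotg [g' gK g'K]]; split=> [|x y].
  by exists (fun y => g' (y - t)) => x; rewrite ?[t + _]addrC ?addrK ?g'K ?subrK.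
have edistE u v : edist u v = Num.sqrt (dot (u - v) (u - v)).
  by congr Num.sqrt; apply: eq_bigr => i _; rewrite !mxE expr2.
by rewrite !edistE opprD addrACA subrr add0r -addg dotg.
Qed.

Definition householder w x := x - (2%:R * dot x w / dot w w) *: w.

Lemma orthogonal_householder w : dot w w != 0 -> orthogonal_map (householder w).
Proof.
move=> ww_neq0; split=> [x y|x|].
- rewrite /householder dotBl mulrBr mulrBl scalerBl.
  by rewrite !opprB addrACA [RHS]addrACA [- y - _]addrC.
- rewrite /householder; set c := (_ / _).
  rewrite dotBl dotZl [dot x _]dotC [dot w (_ - _)]dotC !dotBl !dotZl (dotC w x).
  by rewrite /c; field.
have K : involutive (householder w).
  move=> x; rewrite {1}/householder.
  have -> : dot (householder w x) w = - dot x w.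
    by rewrite dotBl dotZl; field.
  by rewrite /householder mulrN mulNr scaleNr opprK subrK.
by exists (householder w).
Qed.

Lemma exists_nonroot (p : {poly R}) : p != 0 -> exists a, ~~ root p a.
Proof.
move=> p_neq0; pose s := [seq n%:R : R | n <- iota 0 (size p)].
have uniq_s : uniq s.
  by rewrite map_inj_uniq ?iota_uniq // => a b /eqP; rewrite eqr_nat => /eqP.
have : ~~ all (root p) s.
  apply/negP => all_s; have := max_poly_roots p_neq0 all_s uniq_s.
  by rewrite size_map size_iota ltnn.
by case/allPn => a _ ?; exists a.
Qed.

Lemma horner_rVpoly d (a : R) : (rVpoly d).[a] = dot d (\row_i a ^+ i).
Proof.
rewrite horner_poly; apply: eq_bigr => i _.
by rewrite mxE valK.
Qed.

(** Reflect in the hyperplane orthogonal to [w = (1, a, a^2, ...)].  The i-th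
    coordinate of the image of [d], multiplied by [dot w w], is the value at [a]
    of the polynomial [d_i W - 2 X^i D], where [W = sum_j X^(2j)] and
    [D = sum_j d_j X^j].  This polynomial is nonzero: its constant term is [d_i],
    or [- d_i] if [i = 0], and if it vanishes then so does [X^i D]. *)
Lemma generic_position (ds : seq 'rV[R]_k) : {in ds, forall d, d != 0} ->
  exists2 g, orthogonal_map g & {in ds, forall d i, g d ord0 i != 0}.
Proof.
move=> ds_neq0; case: (posnP k) => [k0|k_gt0].
  exists id => [|d _ i]; first exact: orthogonal_id.
  by have := ltn_ord i; rewrite [X in (_ < X)%N]k0.
pose W : {poly R} := \sum_(j < k) 'X^j ^+ 2.
pose P d (i : 'I_k) := d ord0 i *: W - (rVpoly d * 'X^i) *+ 2.
have W0 : W.[0] = 1.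
  rewrite horner_sum (bigD1 (Ordinal k_gt0)) //= big1 => [|i i_neq0].
    by rewrite expr0 expr1n !hornerE.
  rewrite -exprM hornerXn expr0n muln_eq0 orbF.
  by have -> : (i == 0%N :> nat) = false by apply: negPf.
have P_neq0 d i : d \in ds -> P d i != 0.
  move=> /ds_neq0; apply: contraNneq => P0.
  have di0 : d ord0 i = 0.
    have := congr1 (fun p => p.[0]) P0.
    rewrite /P !hornerE W0 mulr1 ?hornerXn horner_coef0.
    rewrite (coef_rVpoly_ord d (Ordinal k_gt0)) expr0n => /eqP.
    case: (eqVneq i (Ordinal k_gt0)) => [-> | i_neq0] /=.
      by rewrite mulr1 opprD addrA subrr sub0r oppr_eq0 => /eqP.
    have -> : (i == 0%N :> nat) = false by apply: negPf.
    by rewrite mulr0 addr0 subr0 => /eqP.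
  move: P0; rewrite /P di0 scale0r sub0r => /eqP.
  rewrite oppr_eq0 -mulr_natr mulf_eq0 mulf_eq0 -polyC_natr polyC_eq0 pnatr_eq0 orbF.
  rewrite expf_eq0 polyX_eq0 andbF orbF => /eqP d0.
  by rewrite -[d]rVpolyK d0 linear0.
pose p := \prod_(d <- ds) \prod_(i < k) P d i.
have p_neq0 : p != 0.
  rewrite prodf_seq_neq0; apply/allP => d dds /=.
  by apply/prodf_neq0 => i _; apply: P_neq0.
have [a Na] := exists_nonroot p_neq0.
pose w : 'rV[R]_k := \row_i a ^+ i.
have wwE : dot w w = W.[a].
  rewrite horner_sum; apply: eq_bigr => i _.
  by rewrite !mxE !hornerE ?hornerXn.
have ww_neq0 : dot w w != 0.
  rewrite psumr_neq0 /=; last by move=> i _; rewrite -expr2 sqr_ge0.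
  apply/hasP; exists (Ordinal k_gt0); first by rewrite mem_index_enum.
  by rewrite !mxE expr0 mulr1 ltr01.
exists (householder w); first exact: orthogonal_householder.
move=> d dds i; apply: contraNneq Na => /= eq0.
rewrite /p /root horner_prod prodf_seq_eq0; apply/hasP; exists d => //=.
rewrite horner_prod; apply/prodf_eq0; exists i => //.
move: eq0; rewrite !mxE => /(congr1 ( *%R (dot w w))); rewrite mulr0 => <-.
rewrite /P !hornerE ?hornerXn -wwE horner_rVpoly -/w; by apply/eqP; field.
Qed.

End Orthogonal.

(** * Rotations of a coordinate plane *)

Section Rotation.
Variables (R : realType) (k : nat) (r r' : 'I_k).
Hypothesis neq_rr' : r != r'.
Local Notation Re := complex.Re.
Local Notation Im := complex.Im.

Definition plane_vec (z : R[i]) : 'rV[R]_k :=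
  Re z *: delta_mx ord0 r + Im z *: delta_mx ord0 r'.
Definition plane_proj (x : 'rV[R]_k) : R[i] :=
  Complex (x ord0 r) (x ord0 r').
Definition rotation (u : R[i]) (x : 'rV[R]_k) : 'rV[R]_k :=
  x + plane_vec ((u - 1) * plane_proj x).

Lemma plane_vec_is_additive : zmod_morphism plane_vec.
Proof.
move=> z w; rewrite /plane_vec !raddfB /= !scalerBl.
by rewrite opprD addrACA.
Qed.
HB.instance Definition _ :=
  GRing.isZmodMorphism.Build _ _ plane_vec plane_vec_is_additive.

Lemma plane_proj_is_additive : zmod_morphism plane_proj.
Proof. by move=> x y; apply/eqP; rewrite eq_complex /= !mxE !eqxx. Qed.
HB.instance Definition _ :=
  GRing.isZmodMorphism.Build _ _ plane_proj plane_proj_is_additive.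

Lemma plane_vecD z w : plane_vec (z + w) = plane_vec z + plane_vec w.
Proof. exact: raddfD. Qed.
Lemma plane_vecB z w : plane_vec (z - w) = plane_vec z - plane_vec w.
Proof. exact: raddfB. Qed.
Lemma plane_projD x y : plane_proj (x + y) = plane_proj x + plane_proj y.
Proof. exact: raddfD. Qed.

Lemma plane_vecK : cancel plane_vec plane_proj.
Proof.
move=> [a b]; apply/eqP; rewrite eq_complex /= !mxE /= !eqxx /=.
rewrite [r' == r]eq_sym (negPf neq_rr').
by rewrite !mulr1 !mulr0 addr0 add0r !eqxx.
Qed.

Lemma rotation_is_additive u : zmod_morphism (rotation u).
Proof.
move=> x y; rewrite /rotation plane_proj_is_additive mulrBr plane_vecB.
by rewrite (opprD y) addrACA.
Qed.

Lemma rotation_comp u v x : rotation u (rotation v x) = rotation (u * v) x.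
Proof.
rewrite /rotation plane_projD plane_vecK -addrA -plane_vecD.
by congr (_ + plane_vec _); ring.
Qed.

Lemma rotation1 x : rotation 1 x = x.
Proof. by rewrite /rotation subrr mul0r raddf0 addr0. Qed.

Lemma orthogonal_rotation u : `|u| = 1 -> orthogonal_map (rotation u).
Proof.
move=> u1; have u_neq0 : u != 0 by rewrite -normr_eq0 u1 oner_eq0.
split=> [|x|]; first exact: rotation_is_additive; last first.
  by exists (rotation u^-1) => x;
    rewrite rotation_comp ?mulVf ?divff ?rotation1.
have uu1 : Re u ^+ 2 + Im u ^+ 2 = 1.
  by apply: (@complexI R); rewrite add_Re2_Im2 u1 expr1n.
have neq_r'r : r' != r by rewrite eq_sym.
have split_plane (v : 'rV[R]_k) :
    dot v v = (v ord0 r * v ord0 r + v ord0 r' * v ord0 r') +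
    \sum_(i | (i != r) && (i != r')) v ord0 i * v ord0 i.
  by rewrite /dot (bigD1 r) //= (bigD1 r') //= addrA.
rewrite !split_plane; congr (_ + _).
  rewrite !mxE !eqxx /= (negPf neq_rr') (negPf neq_r'r) !mulr1 !mulr0 addr0 add0r.
  case: u uu1 {u1 u_neq0} => a b /= uu1; rewrite subr0.
  transitivity ((a ^+ 2 + b ^+ 2) * (x ord0 r ^+ 2 + x ord0 r' ^+ 2)); first by ring.
  by rewrite uu1 mul1r !expr2.
apply: eq_bigr => j /andP[/negPf jr /negPf jr'].
by rewrite !mxE /= jr jr' !mulr0 !addr0.
Qed.

Lemma rotation_fix u x : plane_proj x = 0 -> rotation u x = x.
Proof. by rewrite /rotation => ->; rewrite mulr0 raddf0 addr0. Qed.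

Lemma rotation_plane_vec u z : rotation u (plane_vec z) = plane_vec (u * z).
Proof. by rewrite /rotation plane_vecK -plane_vecD mulrBl mul1r addrC subrK. Qed.

Lemma rotationE u x :
  rotation u x = plane_vec (u * plane_proj x) + (x - plane_vec (plane_proj x)).
Proof. by rewrite /rotation mulrBl mul1r plane_vecB addrCA. Qed.

End Rotation.

(** * Functions killed by a finite set and its dilates *)

Section KilledFunctions.
Variables (R : realType) (k : nat) (ds : seq 'rV[R]_k) (Q : nat).
Hypothesis Q_gt0 : (0 < Q)%N.
Hypothesis ds_generic : {in ds, forall (d : 'rV[R]_k) i, d ord0 i != 0}.
Implicit Types (h : 'rV[R]_k -> int) (g : 'rV[R]_k -> 'rV[R]_k).

Definition killed h := forall g, orthogonal_map g -> forall j t,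
  h t + \sum_(d <- ds) h (t + g d *+ (1 + j * Q)) = 0.

Lemma killed_diff h v : killed h -> killed (diff h v).
Proof.
move=> hP g orth_g j t; rewrite /diff sumrB.
have := hP g orth_g j t; have := hP g orth_g j (t + v).
under eq_bigr do rewrite addrAC.
by move=> /eqP; rewrite addr_eq0 => /eqP-> /eqP; rewrite addr_eq0 => /eqP->;
  rewrite addrACA addNr opprK subrr addr0.
Qed.

Lemma killed_product h g : killed h -> orthogonal_map g ->
  foldl diff h [seq g d *+ Q | d <- ds] =1 fun=> 0.
Proof.
move=> hP orth_g; pose Fs := [seq (g d *+ Q, fun t => h (t + g d)) | d <- ds].
have -> : [seq g d *+ Q | d <- ds] = [seq F.1 | F <- Fs] by rewrite -map_comp.
apply: eliminate => j t; rewrite big_map /= -[RHS](hP g orth_g j t).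
congr (_ + _); apply: eq_bigr => d _.
by rewrite mulrnDr mulr1n [(j * _)%N]mulnC mulrnA [g d + _]addrC addrA.
Qed.

Definition component (s : 'I_k) (d : 'rV[R]_k) : 'rV[R]_k :=
  d ord0 s *: delta_mx ord0 s.

Definition component_periods g (n : nat) h :=
  forall s : 'I_k, (s < n)%N -> {in ds, forall d, period h (g (component s d))}.

(** Periods that are known for the components of index below [n] suffice to
    conclude that [h] is 0. *)
Definition vanishing_from n := forall g h, orthogonal_map g -> killed h ->
  component_periods g n h -> h =1 fun=> 0.

(** Branch over the rotations, in the plane of the coordinates [r] and [r'], by
    the units provided by [planar_saturation]: the group of periods then contains
    the images under [g] of the components [r] and [r'] of all [d], rotated by
    one and the same unit [y].  The components of index below [r] are fixed by
    this rotation, so [g] followed by it has all the periods required. *)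
Lemma vanishing_step (r r' : 'I_k) : r' = r.+1 :> nat ->
  vanishing_from r.+2 -> vanishing_from r.
Proof.
move=> r'E van g h orth_g hP perh; have [addg _ _] := orth_g.
have neq_rr' : r != r' by rewrite -val_eqE /= r'E neq_ltn leqnn.
have p_neq0 : {in ds, forall d, plane_proj r r' d *+ Q != 0}.
  move=> d /ds_generic dP; rewrite mulrn_eq0 negb_or -lt0n Q_gt0 /=.
  by rewrite eq_complex /= negb_and dP.
pose Z := [seq Complex (d ord0 r) 0 | d : 'rV[R]_k <- ds] ++
  [seq Complex 0 (d ord0 r') | d : 'rV[R]_k <- ds].
have [U [U1 satur]] := planar_saturation Z p_neq0.
pose P h := killed h /\ component_periods g r h.
pose L := [seq [seq g (rotation r r' u d) *+ Q | d <- ds] | u <- U].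
apply: (@branch_on_periods _ P L) => //.
- move=> {hP perh}h v [hP perh]; split; first exact: killed_diff.
  by move=> s ltsr d dds; apply: period_diff; apply: perh.
- move=> {hP perh}h vs [hP _] /mapP[u uU ->].
  apply: (killed_product (g := g \o rotation r r' u)) => //.
  by apply: orthogonal_comp => //; apply: orthogonal_rotation => //; apply: U1.
move=> {hP perh}h [hP perh] perU.
pose J := g \o @plane_vec R k r r'.
have addJ : zmod_morphism J by move=> x y; rewrite /J /= raddfB addg.
pose Ja : {additive R[i] -> 'rV[R]_k} :=
  HB.pack J (GRing.isZmodMorphism.Build _ _ J addJ).
pose q d := g (d - plane_vec r r' (plane_proj r r' d)) *+ Q.
pose ga : {additive 'rV[R]_k -> 'rV[R]_k} :=
  HB.pack g (GRing.isZmodMorphism.Build _ _ g addg).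
have [u uU|y y1 yZ] := satur _ _ Ja q (period_zmod_closed h).
  have [_ /mapP[d dds ->] hd] := perU _ (map_f _ uU).
  exists d => //; rewrite inE /=.
  suff -> : J (u * (plane_proj r r' d *+ Q)) + q d = g (rotation r r' u d) *+ Q.
    by [].
  rewrite rotationE // -[g (_ + _)]/(ga (_ + _)) raddfD mulrnDl.
  by rewrite -[J _]/(Ja _) mulrnAr raddfMn.
apply: (van (g \o rotation r r' y) h) => //.
  by apply: orthogonal_comp => //; apply: orthogonal_rotation.
move=> s lts d dds; rewrite /=.
have [-> | neq_sr] := eqVneq s r.
  have -> : component r d = plane_vec r r' (Complex (d ord0 r) 0).
    by rewrite /plane_vec /= scale0r addr0.
  rewrite rotation_plane_vec // mulrC.
  have : Complex (d ord0 r) 0 \in Z.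
    by rewrite mem_cat; apply/orP; left; apply/mapP; exists d.
  by move/yZ; rewrite inE.
have [-> | neq_sr'] := eqVneq s r'.
  have -> : component r' d = plane_vec r r' (Complex 0 (d ord0 r')).
    by rewrite /plane_vec /= scale0r add0r.
  rewrite rotation_plane_vec // mulrC.
  have : Complex 0 (d ord0 r') \in Z.
    by rewrite mem_cat; apply/orP; right; apply/mapP; exists d.
  by move/yZ; rewrite inE.
rewrite rotation_fix; last first.
  rewrite /plane_proj /component !mxE /= ![_ == s]eq_sym.
  by rewrite (negPf neq_sr) (negPf neq_sr') !mulr0.
apply: perh => //; move: lts; rewrite !ltnS leq_eqVlt ltnS leq_eqVlt.
by rewrite -r'E !val_eqE (negPf neq_sr) (negPf neq_sr').
Qed.

Lemma vanishing_all : vanishing_from k.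
Proof.
move=> g h orth_g hP perh t; have [addg _ _] := orth_g.
pose ga : {additive 'rV[R]_k -> 'rV[R]_k} :=
  HB.pack g (GRing.isZmodMorphism.Build _ _ g addg).
have perd d : d \in ds -> period h (g d).
  move=> dds; suff : g d \in [pred v | `[< period h v >]] by rewrite inE.
  have -> : g d = \sum_s g (component s d).
    by rewrite -[g d]/(ga d) {1}[d]row_sum_delta raddf_sum.
  elim/big_ind: _ => [|x y|s _].
  - exact: subgroup0 (period_zmod_closed h).
  - exact: (subgroupD (period_zmod_closed h)).
  by rewrite inE; apply: perh.
have := hP g orth_g 0%N t; rewrite mul0n addn0.
rewrite big_seq (eq_bigr (fun=> h t)); last by move=> d dds; rewrite mulr1n perd.
rewrite -big_seq big_const_seq count_predT iter_addr_0 -mulrS => /eqP.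
by rewrite mulrn_eq0 => /eqP.
Qed.

(** The step starting at [r = k - 2] provides the last two components; each
    earlier step only uses the first of its two. *)
Lemma killed_eq0 h : (2 <= k)%N -> killed h -> h =1 fun=> 0.
Proof.
move=> k_ge2 hP.
have van m : (m.+2 <= k)%N -> vanishing_from (k - m.+2).
  elim: m => [|m IHm] lemk.
    have ltr : (k - 2 < k)%N by lia.
    have ltr' : (k - 1 < k)%N by lia.
    apply: (@vanishing_step (Ordinal ltr) (Ordinal ltr')) => /=; first by lia.
    have -> : ((k - 2).+2 = k)%N by lia.
    exact: vanishing_all.
  have ltr : (k - m.+3 < k)%N by lia.
  have ltr' : (k - m.+2 < k)%N by lia.
  apply: (@vanishing_step (Ordinal ltr) (Ordinal ltr')) => /=; first by lia.
  move=> g f orth_g fP perf; apply: (IHm (ltnW lemk) g) => // s lts.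
  by apply: perf; lia.
have := van (k - 2)%N; have -> : (k - (k - 2).+2 = 0)%N by lia.
apply; [lia | exact: orthogonal_id | exact: hP | by []].
Qed.

End KilledFunctions.

(** * The theorem *)

Lemma steinhaus_tiles (R : realType) (k : nat) (X : seq 'rV[R]_k)
    (S : set 'rV[R]_k) g :
    uniq X -> steinhaus_set [set` X]%classic S -> orthogonal_map g ->
  tiles [seq g x | x <- X] (fun t => `[< S t >]).
Proof.
move=> uniqX steinS orth_g t; have iso := orthogonal_isometry t orth_g.
have [|z [[Sz [x0 x0X zE]] z_uniq]] :=
    steinS ((fun x => t + g x) @` [set` X])%classic.
  by exists (fun x => t + g x).
have g_inj : injective g by have [_ _ /bij_inj] := orth_g.
rewrite big_map -big_mkcond sum1_count.
rewrite (eq_in_count (a2 := pred1 x0)) ?count_uniq_mem ?x0X // => x xX /=.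
apply/asboolP/eqP => [Sx|->]; last by rewrite zE.
apply/g_inj/(addrI t); rewrite [RHS]zE; apply/esym/z_uniq.
by split=> //; exists x.
Qed.

Theorem corollary2p5 (R : realType) (k : nat) (hk : (2 <= k)%N)
    (K : set 'rV[R]_k) (hfin : finite_set K)
    (htwo : exists x y : 'rV[R]_k, [/\ K x, K y & x <> y]) :
  jackson_set K.
Proof.
split=> // -[S steinS].
have /finite_seqP[s KE] := hfin; pose X := undup s.
have KX : K = [set` X]%classic.
  by rewrite KE; apply/seteqP; split=> x; rewrite /= mem_undup.
have uniqX : uniq X by apply: undup_uniq.
have X_ge2 : (1 < size X)%N.
  have [x [y [Kx Ky /eqP neq_xy]]] := htwo.
  rewrite KX /= in Kx Ky.
  rewrite ltnNge; apply/negP => X_le1; case/negP: neq_xy.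
  by move: X_le1 Kx Ky; case: (X) => [|z []] //= _; rewrite !inE => /eqP-> /eqP->.
rewrite {}KX {KE hfin htwo K} in steinS *.
case defX : X => [|x0 X']; first by rewrite defX in X_ge2.
have tilesX g : orthogonal_map g -> tiles [seq g x | x <- X] (fun t => `[< S t >]).
  exact: steinhaus_tiles.
pose ds0 := [seq x - x0 | x <- X'].
have [|kap orth_kap ds_generic0] := @generic_position R k ds0.
  move=> _ /mapP[x xX' ->]; rewrite subr_eq0; apply: contraTneq uniqX => x_x0.
  by rewrite defX /= -x_x0 xX'.
pose ds := map kap ds0.
have ds_generic : {in ds, forall (d : 'rV[R]_k) i, d ord0 i != 0}.
  by move=> _ /mapP[d dds ->]; apply: ds_generic0.
pose n := size X; pose h t : int := n%:Z * (`[< S t >] : nat)%:Z - 1.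
have h_killed : killed ds n`! h.
  move=> g orth_g j t; have orth_gk := orthogonal_comp orth_g orth_kap.
  have := tiles_dilate_fact j (tilesX _ orth_gk).
  set m := (1 + _)%N; rewrite size_map -/n in m *.
  move=> /(_ (t - g (kap x0) *+ m)); rewrite -map_comp big_map defX big_cons /=.
  rewrite subrK => eq1.
  have eq_sum : (`[< S t >] + \sum_(d <- ds) `[< S (t + g d *+ m)%R >] = 1)%N.
    rewrite -[RHS]eq1 !big_map; congr (_ + _)%N; apply: eq_bigr => x _.
    have [addg _ _] := orth_g; have [addk _ _] := orth_kap.
    by rewrite addk addg mulrnBl /= addrA addrAC.
  have size_ds : n%:Z = 1 + (size ds)%:Z.
    by rewrite /n defX !size_map.
  transitivity (n%:Z * (`[< S t >] + \sum_(d <- ds) `[< S (t + g d *+ m)%R >])%N%:Z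
      - (1 + (size ds)%:Z)).
    rewrite /h sumrB -mulr_sumr big_const_seq count_predT iter_addr_0.
    rewrite PoszD mulrDr opprD addrACA; congr (_ + _ + (_ - _)).
      by congr (_ * _); elim/big_rec2: _ => // d a b _ ->; rewrite PoszD.
    by rewrite natz.
  by rewrite eq_sum mulr1 size_ds subrr.
have := killed_eq0 (fact_gt0 n) ds_generic hk h_killed 0.
rewrite /h => /eqP; rewrite subr_eq0; case: `[< _ >]; rewrite ?mulr0 // mulr1.
by rewrite eqz_nat gtn_eqF.
Qed.
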